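(* Let $R$ be a ring with local units and let $P$ be a locally projective left $R$-module. Assume that $S$ is a subring of $\mathrm{End}_R(P)$ (itself a ring with local units) such that $P$ is a unitary right $S$-module, $S\,\mathrm{End}_R(P)=S$, and $Pf$ is a finitely generated left $R$-module for each idempotent $f=f^2\in S$. Then the functor $S\mathrm{Hom}_R(P,-):\mathscr{C}_P\rightarrow S\mathrm{Mod}$ is an equivalence of categories.
   Context: Rings are associative, not necessarily with identity. A ring $R$ has local units if every finite subset of $R$ is contained in a subring of the form $eRe$ with $e^2=e\in R$. A left $R$-module $M$ is unitary if $RM=M$ (similarly on the right); $R\mathrm{Mod}$ is the category of unitary left $R$-modules. Homomorphisms of left modules are written on the right, so $fg$ means ''first $f$, then $g$''; in particular $\mathrm{End}_R(P)$ acts on $P$ from the right, and a subring $S\subseteq \mathrm{End}_R(P)$ (not required to contain $\mathrm{id}_P$) makes $P$ an $R$-$S$-bimodule. $S\,\mathrm{End}_R(P)$ is the set of finite sums of products $sg$ with $s\in S$, $g\in\mathrm{End}_R(P)$. Locally projective: a split direct system over a quasi-ordered directed set $I$ is a direct system $(P_i,\varphi_{ij})_{i\le j}$ together with homomorphisms $\psi_{ji}:P_j\to P_i$ for $i\le j$ with $\varphi_{ij}\psi_{ji}=\mathrm{id}_{P_i}$ and $\psi_{kj}\psi_{ji}=\psi_{ki}$ for $i\le j\le k$. A unitary left $R$-module is locally projective if it is a direct limit of a split direct system of finitely generated unitary left $R$-modules which are projective in $R\mathrm{Mod}$. For an $R$-$S$-bimodule $P$ and a left $R$-module $M$, $\mathrm{Hom}_R(P,M)$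 is a left $S$-module via $(x)(sg)=(xs)g$, and $S\mathrm{Hom}_R(P,M)$ (finite sums of elements $sg$) is its largest unitary $S$-submodule; $S\mathrm{Hom}_R(P,-)$ acts on morphisms by composition. $\mathscr{C}_P$ is the full subcategory of $R\mathrm{Mod}$ whose objects are the unitary left $R$-modules $M$ such that (i) $\mathrm{st}_P(M)=0$, where $\mathrm{st}_P(M)$ is the sum of all $R$-submodules $K$ of $M$ with $S\mathrm{Hom}_R(P,K)=0$; and (ii) $\mathrm{sTr}(P,M)=M$, where $\mathrm{sTr}(P,M)=\sum_{g\in S\mathrm{Hom}_R(P,M)}\mathrm{Im}\,g$. *)

(* Defs.v *)
From HB Require Import structures.
From mathcomp Require Import all_boot all_order all_algebra.
From mathcomp Require Import boolp classical_sets functions cardinality.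

Set Implicit Arguments.
Unset Strict Implicit.
Unset Printing Implicit Defensive.

Import GRing.Theory.
Local Open Scope ring_scope.
Local Open Scope classical_set_scope.

Reserved Notation "x ** y" (at level 40, left associativity).
Reserved Notation "r *> m" (at level 40, left associativity).

(* Associative rings, not necessarily with identity, and their left modules:
   the ring and module structures of MathComp all require an identity.
   The underlying additive groups are MathComp's.                             *)

HB.mixin Record Zmodule_isRng R of GRing.Zmodule R := {
  rng_mul : R -> R -> R;
  rng_mulA : associative rng_mul;
  rng_mulDl : left_distributive rng_mul +%R;
  rng_mulDr : right_distributive rng_mul +%R
}.

#[short(type="rngType")]
HB.structure Definition Rng := {R of Zmodule_isRng R & GRing.Zmodule R}.

Notation "x ** y" := (rng_mul x y) : ring_scope.

HB.mixin Record Zmodule_isRngModule (R : rngType) M of GRing.Zmodule M := {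
  rng_act : R -> M -> M;
  rng_actA : forall r s m, rng_act r (rng_act s m) = rng_act (r ** s) m;
  rng_actDl : forall m r s, rng_act (r + s) m = rng_act r m + rng_act s m;
  rng_actDr : forall r m n, rng_act r (m + n) = rng_act r m + rng_act r n
}.

#[short(type="rngModType")]
HB.structure Definition RngModule (R : rngType) :=
  {M of Zmodule_isRngModule R M & GRing.Zmodule M}.

Notation "r *> m" := (rng_act r m) : ring_scope.

(* The products RM, PS, S End(P) and S Hom(P, M) are sets of finite sums. *)
Definition fin_sums (V : zmodType) (X : set V) : set V :=
  [set v | exists2 s : seq V, {in s, forall x, X x} & v = \sum_(x <- s) x].

Definition rng_idem (R : rngType) (e : R) : Prop := e ** e = e.

Definition local_units (R : rngType) : Prop :=
  forall A : set R, finite_set A ->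
    exists2 e : R, rng_idem e & A `<=` [set e ** r ** e | r in [set: R]].

Record subrng (R : rngType) := Subrng {
  subrng_set :> set R;
  subrng0 : subrng_set 0;
  subrngB : forall x y, subrng_set x -> subrng_set y -> subrng_set (x - y);
  subrngM : forall x y, subrng_set x -> subrng_set y -> subrng_set (x ** y)
}.

Record submodule (R : rngType) (M : rngModType R) := Submodule {
  submodule_set :> set M;
  submodule0 : submodule_set 0;
  submoduleB : forall x y,
    submodule_set x -> submodule_set y -> submodule_set (x - y);
  submodule_act : forall r x, submodule_set x -> submodule_set (r *> x)
}.

Definition subrng_pred (R : rngType) (A : subrng R) : {pred R} :=
  fun x => `[< subrng_set A x >].

Lemma subrng_zmod_closed (R : rngType) (A : subrng R) :
  zmod_closed (subrng_pred A).
Proof.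
split=> [|x y]; first by apply/asboolP; exact: subrng0.
by move=> /asboolP Ax /asboolP Ay; apply/asboolP; exact: subrngB.
Qed.

HB.instance Definition _ (R : rngType) (A : subrng R) :=
  GRing.isZmodClosed.Build R (subrng_pred A) (subrng_zmod_closed A).

Record subrng_type (R : rngType) (A : subrng R) := SubrngType {
  subrng_val :> R;
  subrng_valP : subrng_val \in subrng_pred A
}.

HB.instance Definition _ (R : rngType) (A : subrng R) :=
  [isSub for @subrng_val R A].
HB.instance Definition _ (R : rngType) (A : subrng R) :=
  [Choice of subrng_type A by <:].
HB.instance Definition _ (R : rngType) (A : subrng R) :=
  [SubChoice_isSubZmodule of subrng_type A by <:].

Lemma subrng_mul_subproof (R : rngType) (A : subrng R) (x y : subrng_type A) :
  (x : R) ** (y : R) \in subrng_pred A.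
Proof.
by apply/asboolP; apply: subrngM; apply/asboolP; exact: subrng_valP.
Qed.

Definition subrng_mul (R : rngType) (A : subrng R) (x y : subrng_type A) :
  subrng_type A := SubrngType (subrng_mul_subproof x y).

Lemma subrng_mulA (R : rngType) (A : subrng R) : associative (@subrng_mul R A).
Proof. by move=> x y z; apply: val_inj; exact: rng_mulA. Qed.

Lemma subrng_mulDl (R : rngType) (A : subrng R) :
  left_distributive (@subrng_mul R A) +%R.
Proof. by move=> x y z; apply: val_inj; exact: rng_mulDl. Qed.

Lemma subrng_mulDr (R : rngType) (A : subrng R) :
  right_distributive (@subrng_mul R A) +%R.
Proof. by move=> x y z; apply: val_inj; exact: rng_mulDr. Qed.

HB.instance Definition _ (R : rngType) (A : subrng R) :=
  Zmodule_isRng.Build (subrng_type A)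
    (@subrng_mulA R A) (@subrng_mulDl R A) (@subrng_mulDr R A).

Definition submodule_pred (R : rngType) (M : rngModType R) (K : submodule M) :
  {pred M} := fun x => `[< submodule_set K x >].

Lemma submodule_zmod_closed (R : rngType) (M : rngModType R)
  (K : submodule M) : zmod_closed (submodule_pred K).
Proof.
split=> [|x y]; first by apply/asboolP; exact: submodule0.
by move=> /asboolP Kx /asboolP Ky; apply/asboolP; exact: submoduleB.
Qed.

HB.instance Definition _ (R : rngType) (M : rngModType R) (K : submodule M) :=
  GRing.isZmodClosed.Build M (submodule_pred K) (submodule_zmod_closed K).

Record submodule_type (R : rngType) (M : rngModType R) (K : submodule M) :=
  SubmoduleType {
    submodule_val :> M;
    submodule_valP : submodule_val \in submodule_pred K
  }.

HB.instance Definition _ (R : rngType) (M : rngModType R) (K : submodule M) :=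
  [isSub for @submodule_val R M K].
HB.instance Definition _ (R : rngType) (M : rngModType R) (K : submodule M) :=
  [Choice of submodule_type K by <:].
HB.instance Definition _ (R : rngType) (M : rngModType R) (K : submodule M) :=
  [SubChoice_isSubZmodule of submodule_type K by <:].

Lemma submodule_act_subproof (R : rngType) (M : rngModType R)
  (K : submodule M) (r : R) (x : submodule_type K) :
  r *> (x : M) \in submodule_pred K.
Proof.
by apply/asboolP; apply: submodule_act; apply/asboolP; exact: submodule_valP.
Qed.

Definition submodule_type_act (R : rngType) (M : rngModType R)
  (K : submodule M) (r : R) (x : submodule_type K) : submodule_type K :=
  SubmoduleType (submodule_act_subproof r x).

Lemma submodule_type_actA (R : rngType) (M : rngModType R) (K : submodule M)
  (r s : R) (x : submodule_type K) :
  submodule_type_act r (submodule_type_act s x)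
  = submodule_type_act (r ** s) x.
Proof. by apply: val_inj; exact: rng_actA. Qed.

Lemma submodule_type_actDl (R : rngType) (M : rngModType R) (K : submodule M)
  (x : submodule_type K) (r s : R) :
  submodule_type_act (r + s) x
  = submodule_type_act r x + submodule_type_act s x.
Proof. by apply: val_inj; exact: rng_actDl. Qed.

Lemma submodule_type_actDr (R : rngType) (M : rngModType R) (K : submodule M)
  (r : R) (x y : submodule_type K) :
  submodule_type_act r (x + y)
  = submodule_type_act r x + submodule_type_act r y.
Proof. by apply: val_inj; exact: rng_actDr. Qed.

HB.instance Definition _ (R : rngType) (M : rngModType R) (K : submodule M) :=
  Zmodule_isRngModule.Build R (submodule_type K)
    (@submodule_type_actA R M K) (@submodule_type_actDl R M K)
    (@submodule_type_actDr R M K).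

(* R M, which is the largest unitary submodule of M if R R = R. *)

Definition rng_prod (R : rngType) (M : rngModType R) : set M :=
  fin_sums [set r *> m | r in [set: R] & m in [set: M]].
Arguments rng_prod {R} M _ : rename.

Definition unitary (R : rngType) (M : rngModType R) : Prop :=
  rng_prod M = [set: M].

Lemma fin_sumsD (V : zmodType) (X : set V) (u v : V) :
  fin_sums X u -> fin_sums X v -> fin_sums X (u + v).
Proof.
move=> [s Xs ->] [t Xt ->]; exists (s ++ t); last by rewrite big_cat.
by move=> x; rewrite mem_cat => /orP[xs|xt]; [exact: Xs|exact: Xt].
Qed.

Lemma fin_sums_morph (V W : zmodType) (f : V -> W) (X : set V) (Y : set W)
  (v : V) : zmod_morphism f -> (forall x, X x -> Y (f x)) ->
  fin_sums X v -> fin_sums Y (f v).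
Proof.
move=> fB XY [s Xs ->].
have f0 : f 0 = 0 by rewrite -[X in f X](subrr 0) fB subrr.
have fN x : f (- x) = - f x by rewrite -sub0r fB f0 sub0r.
have fD x y : f (x + y) = f x + f y by rewrite -{1}[y]opprK fB fN opprK.
exists [seq f x | x <- s].
  by move=> _ /mapP[x sx ->]; apply: XY; exact: Xs.
by rewrite big_map; elim/big_rec2: _ => // x a b _ <-; rewrite fD.
Qed.

Lemma rng_act0 (R : rngType) (M : rngModType R) (r : R) : r *> (0 : M) = 0.
Proof. by apply: (addrI (r *> (0 : M))); rewrite -rng_actDr !addr0. Qed.

Lemma rng_actN (R : rngType) (M : rngModType R) (r : R) (m : M) :
  r *> (- m) = - (r *> m).
Proof. by apply: (addrI (r *> m)); rewrite -rng_actDr !subrr rng_act0. Qed.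

Lemma rng_prod0 (R : rngType) (M : rngModType R) : rng_prod M 0.
Proof. by exists [::] => //; rewrite big_nil. Qed.

Lemma rng_prodB (R : rngType) (M : rngModType R) (x y : M) :
  rng_prod M x -> rng_prod M y -> rng_prod M (x - y).
Proof.
move=> Mx My; apply: fin_sumsD => //.
apply: fin_sums_morph My => [a b|_ [r _ [m _ <-]]].
  exact: raddfB.
by exists r => //; exists (- m) => //; rewrite rng_actN.
Qed.

Lemma rng_prod_act (R : rngType) (M : rngModType R) (r : R) (x : M) :
  rng_prod M x -> rng_prod M (r *> x).
Proof.
apply: fin_sums_morph => [a b|_ [s _ [m _ <-]]].
  by rewrite rng_actDr rng_actN.
by exists r => //; exists (s *> m).
Qed.

Definition rng_prod_submodule (R : rngType) (M : rngModType R) : submodule M :=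
  Submodule (@rng_prod0 R M) (@rng_prodB R M) (@rng_prod_act R M).

Definition hom_pred (R : rngType) (M N : rngModType R) : {pred M -> N} :=
  fun f => `[< zmod_morphism f /\ forall r m, f (r *> m) = r *> f m >].

Lemma hom_zmod_closed (R : rngType) (M N : rngModType R) :
  zmod_closed (@hom_pred R M N).
Proof.
split=> [|f g].
  by apply/asboolP; split=> [x y|r m]; rewrite ?subrr ?rng_act0.
move=> /asboolP[fB fZ] /asboolP[gB gZ]; apply/asboolP; split=> [x y|r m].
  by rewrite !fctE fB gB opprD addrACA -opprD.
by rewrite !fctE fZ gZ rng_actDr rng_actN.
Qed.

HB.instance Definition _ (R : rngType) (M N : rngModType R) :=
  GRing.isZmodClosed.Build (M -> N) (@hom_pred R M N) (hom_zmod_closed M N).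

Record rng_hom (R : rngType) (M N : rngModType R) := Hom {
  hom_fun :> M -> N;
  hom_funP : hom_fun \in @hom_pred R M N
}.

HB.instance Definition _ (R : rngType) (M N : rngModType R) :=
  [isSub for @hom_fun R M N].
HB.instance Definition _ (R : rngType) (M N : rngModType R) :=
  [Choice of rng_hom M N by <:].
HB.instance Definition _ (R : rngType) (M N : rngModType R) :=
  [SubChoice_isSubZmodule of rng_hom M N by <:].

Lemma homB (R : rngType) (M N : rngModType R) (f : rng_hom M N) :
  zmod_morphism f.
Proof. by have /asboolP[] := hom_funP f. Qed.

Lemma homZ (R : rngType) (M N : rngModType R) (f : rng_hom M N)
  (r : R) (m : M) :
  f (r *> m) = r *> f m.
Proof. by have /asboolP[] := hom_funP f. Qed.

Lemma rng_homP (R : rngType) (M N : rngModType R) (f g : rng_hom M N) :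
  f =1 g -> f = g.
Proof. by move=> fg; apply: val_inj; exact/funext. Qed.

Lemma homD (R : rngType) (M N : rngModType R) (f : rng_hom M N) :
  {morph f : x y / x + y}.
Proof.
move=> x y; have f0 : f 0 = 0 by rewrite -[X in f X](subrr 0) homB subrr.
by rewrite -{1}[y]opprK homB -[in f (- y)]sub0r homB f0 sub0r opprK.
Qed.

Lemma hom_id_subproof (R : rngType) (M : rngModType R) :
  @id M \in @hom_pred R M M.
Proof. exact/asboolP. Qed.

Definition hom_id (R : rngType) (M : rngModType R) : rng_hom M M :=
  Hom (hom_id_subproof M).

Lemma hom_comp_subproof (R : rngType) (M N L : rngModType R)
  (f : rng_hom M N) (g : rng_hom N L) : (fun x => g (f x)) \in @hom_pred R M L.
Proof. by apply/asboolP; split=> [x y|r x]; rewrite ?homB ?homZ. Qed.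

(* Homomorphisms are written on the right: first f, then g. *)
Definition hom_comp (R : rngType) (M N L : rngModType R)
  (f : rng_hom M N) (g : rng_hom N L) : rng_hom M L :=
  Hom (hom_comp_subproof f g).

Definition endo (R : rngType) (P : rngModType R) := rng_hom P P.

HB.instance Definition _ (R : rngType) (P : rngModType R) :=
  GRing.Zmodule.on (endo P).

Lemma endo_mulA (R : rngType) (P : rngModType R) :
  associative (@hom_comp R P P P : endo P -> endo P -> endo P).
Proof. by move=> f g h; apply: rng_homP. Qed.

Lemma endo_mulDl (R : rngType) (P : rngModType R) :
  left_distributive (@hom_comp R P P P : endo P -> endo P -> endo P) +%R.
Proof. by move=> f g h; apply: rng_homP => x /=; exact: homD. Qed.

Lemma endo_mulDr (R : rngType) (P : rngModType R) :
  right_distributive (@hom_comp R P P P : endo P -> endo P -> endo P) +%R.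
Proof. by move=> f g h; apply: rng_homP. Qed.

HB.instance Definition _ (R : rngType) (P : rngModType R) :=
  Zmodule_isRng.Build (endo P)
    (@endo_mulA R P) (@endo_mulDl R P) (@endo_mulDr R P).

Definition submodule_span (R : rngType) (M : rngModType R) (X : set M) :
  set M := smallest (fun N => exists K : submodule M, N = K) X.

Definition fin_gen (R : rngType) (M : rngModType R) (N : set M) : Prop :=
  exists2 X : set M, finite_set X & N = submodule_span X.

Definition projective (R : rngType) (Q : rngModType R) : Prop :=
  forall (M N : rngModType R) (p : rng_hom M N) (f : rng_hom Q N),
    unitary M -> unitary N -> range p = [set: N] ->
    exists g : rng_hom Q M, hom_comp g p = f.

Record split_system (R : rngType) (d : Order.disp_t) (I : preorderType d) :=
  SplitSystem {
    sys_obj :> I -> rngModType R;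
    sys_phi : forall i j, (i <= j)%O -> rng_hom (sys_obj i) (sys_obj j);
    sys_psi : forall i j, (i <= j)%O -> rng_hom (sys_obj j) (sys_obj i);
    sys_phi_id : forall i (ii : (i <= i)%O), sys_phi ii = hom_id (sys_obj i);
    sys_phi_comp : forall i j k (ij : (i <= j)%O) (jk : (j <= k)%O)
      (ik : (i <= k)%O), hom_comp (sys_phi ij) (sys_phi jk) = sys_phi ik;
    sys_split : forall i j (ij : (i <= j)%O),
      hom_comp (sys_phi ij) (sys_psi ij) = hom_id (sys_obj i);
    sys_psi_comp : forall i j k (ij : (i <= j)%O) (jk : (j <= k)%O)
      (ik : (i <= k)%O), hom_comp (sys_psi jk) (sys_psi ij) = sys_psi ik
  }.

Definition directed d (I : preorderType d) : Prop :=
  inhabited I /\ forall i j : I, exists k : I, (i <= k)%O /\ (j <= k)%O.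

Definition cocone (R : rngType) d (I : preorderType d) (Q : split_system R I)
  (M : rngModType R) (u : forall i, rng_hom (Q i) M) : Prop :=
  forall i j (ij : (i <= j)%O), hom_comp (sys_phi Q ij) (u j) = u i.

(* The direct limit is taken in the category of unitary modules. *)
Definition direct_limit (R : rngType) d (I : preorderType d)
  (Q : split_system R I) (M : rngModType R) : Prop :=
  exists2 u : forall i, rng_hom (Q i) M, cocone u &
    forall (N : rngModType R) (v : forall i, rng_hom (Q i) N), unitary N ->
      cocone v -> exists! h : rng_hom M N, forall i, hom_comp (u i) h = v i.

Definition locally_projective (R : rngType) (P : rngModType R) : Prop :=
  unitary P /\
  exists (d : Order.disp_t) (I : preorderType d) (Q : split_system R I),
    [/\ directed I,
        forall i, [/\ unitary (Q i), fin_gen [set: Q i] & projective (Q i)] &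
        direct_limit Q P].

(* P is a bimodule over R and a subring S of End(P), where x s is s x, the
   value of the endomorphism s at x; then Hom(P, M) is a left S-module, with
   s g = hom_comp s g.                                                        *)

Definition hom_act (R : rngType) (P M : rngModType R) (S : subrng (endo P))
  (s : subrng_type S) (g : rng_hom P M) : rng_hom P M :=
  hom_comp (subrng_val s : rng_hom P P) g.

Lemma hom_actA (R : rngType) (P M : rngModType R) (S : subrng (endo P))
  (s t : subrng_type S) (g : rng_hom P M) :
  hom_act s (hom_act t g) = hom_act (s ** t) g.
Proof. exact: rng_homP. Qed.

Lemma hom_actDl (R : rngType) (P M : rngModType R) (S : subrng (endo P))
  (g : rng_hom P M) (s t : subrng_type S) :
  hom_act (s + t) g = hom_act s g + hom_act t g.
Proof. by apply: rng_homP => x; exact: homD. Qed.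

Lemma hom_actDr (R : rngType) (P M : rngModType R) (S : subrng (endo P))
  (s : subrng_type S) (g h : rng_hom P M) :
  hom_act s (g + h) = hom_act s g + hom_act s h.
Proof. exact: rng_homP. Qed.

HB.instance Definition _ (R : rngType) (P M : rngModType R)
    (S : subrng (endo P)) :=
  Zmodule_isRngModule.Build (subrng_type S) (rng_hom P M)
    (@hom_actA R P M S) (@hom_actDl R P M S) (@hom_actDr R P M S).

Definition SHom (R : rngType) (P : rngModType R) (S : subrng (endo P))
  (M : rngModType R) : submodule (rng_hom P M : rngModType (subrng_type S)) :=
  rng_prod_submodule (rng_hom P M : rngModType (subrng_type S)).

Definition st (R : rngType) (P : rngModType R) (S : subrng (endo P))
  (M : rngModType R) : set M :=
  fin_sums (\bigcup_(K in [set K : submodule M |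
                           (SHom S (submodule_type K) : set _) = [set 0]]) K).
Arguments st {R P} S M _ : rename.

Definition sTr (R : rngType) (P : rngModType R) (S : subrng (endo P))
  (M : rngModType R) : set M :=
  fin_sums (\bigcup_(g in (SHom S M : set _)) range g).
Arguments sTr {R P} S M _ : rename.

(* mor_comp f g is first f, then g. *)

Record category := Category {
  obj :> Type;
  mor : obj -> obj -> Type;
  mor_id : forall a, mor a a;
  mor_comp : forall a b c, mor a b -> mor b c -> mor a c;
  mor_compA : forall a b c d (f : mor a b) (g : mor b c) (h : mor c d),
    mor_comp f (mor_comp g h) = mor_comp (mor_comp f g) h;
  mor_id_comp : forall a b (f : mor a b), mor_comp (mor_id a) f = f;
  mor_comp_id : forall a b (f : mor a b), mor_comp f (mor_id b) = f
}.

Arguments mor {_} _ _.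
Arguments mor_id {_} _.

Definition is_iso (C : category) (a b : C) (f : mor a b) : Prop :=
  exists2 g : mor b a, mor_comp f g = mor_id a & mor_comp g f = mor_id b.

Record functor (C D : category) := Functor {
  fun_obj :> C -> D;
  fun_mor : forall a b, mor a b -> mor (fun_obj a) (fun_obj b);
  fun_id : forall a, fun_mor (mor_id a) = mor_id (fun_obj a);
  fun_comp : forall a b c (f : mor a b) (g : mor b c),
    fun_mor (mor_comp f g) = mor_comp (fun_mor f) (fun_mor g)
}.

Definition functor_id (C : category) : functor C C :=
  @Functor C C id (fun a b f => f) (fun a => erefl) (fun a b c f g => erefl).

Lemma functor_comp_id (C D E : category) (F : functor C D) (G : functor D E)
  (a : C) : fun_mor G (fun_mor F (mor_id a)) = mor_id (G (F a)).
Proof. by rewrite !fun_id. Qed.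

Lemma functor_comp_comp (C D E : category) (F : functor C D)
  (G : functor D E) (a b c : C) (f : mor a b) (g : mor b c) :
  fun_mor G (fun_mor F (mor_comp f g))
  = mor_comp (fun_mor G (fun_mor F f)) (fun_mor G (fun_mor F g)).
Proof. by rewrite !fun_comp. Qed.

Definition functor_comp (C D E : category) (F : functor C D)
  (G : functor D E) : functor C E :=
  @Functor C E (fun a => G (F a)) (fun a b f => fun_mor G (fun_mor F f))
    (functor_comp_id F G) (functor_comp_comp F G).

Definition naturally_isomorphic (C D : category) (F G : functor C D) : Prop :=
  exists2 t : forall a : C, mor (F a) (G a),
    forall (a b : C) (f : mor a b),
      mor_comp (fun_mor F f) (t b) = mor_comp (t a) (fun_mor G f) &
    forall a : C, is_iso (t a).

Definition is_equivalence (C D : category) (F : functor C D) : Prop :=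
  exists G : functor D C,
    naturally_isomorphic (functor_comp F G) (functor_id C) /\
    naturally_isomorphic (functor_comp G F) (functor_id D).

Definition full_subcategory (C : category) (X : C -> Prop) : category :=
  @Category {a : C | X a} (fun a b => mor (sval a) (sval b))
    (fun a => mor_id (sval a)) (fun a b c f g => mor_comp f g)
    (fun a b c d f g h => mor_compA f g h)
    (fun a b f => mor_id_comp f) (fun a b f => mor_comp_id f).

Lemma hom_compA (R : rngType) (M N L K : rngModType R)
  (f : rng_hom M N) (g : rng_hom N L) (h : rng_hom L K) :
  hom_comp f (hom_comp g h) = hom_comp (hom_comp f g) h.
Proof. exact: rng_homP. Qed.

Lemma hom_id_comp (R : rngType) (M N : rngModType R) (f : rng_hom M N) :
  hom_comp (hom_id M) f = f.
Proof. exact: rng_homP. Qed.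

Lemma hom_comp_id (R : rngType) (M N : rngModType R) (f : rng_hom M N) :
  hom_comp f (hom_id N) = f.
Proof. exact: rng_homP. Qed.

(* All left R-modules, unitary or not. *)
Definition all_modules (R : rngType) : category :=
  @Category (rngModType R) (@rng_hom R) (@hom_id R) (@hom_comp R)
    (@hom_compA R) (@hom_id_comp R) (@hom_comp_id R).

Definition RMod (R : rngType) : category :=
  @full_subcategory (all_modules R) (@unitary R).

Definition RMod_module (R : rngType) (M : RMod R) : rngModType R := sval M.

Definition CP (R : rngType) (P : rngModType R) (S : subrng (endo P)) :
  category :=
  @full_subcategory (RMod R) (fun M =>
    st S (RMod_module M) = [set 0] /\
    sTr S (RMod_module M) = [set: RMod_module M]).

Definition CP_module (R : rngType) (P : rngModType R) (S : subrng (endo P))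
  (M : CP S) : rngModType R := RMod_module (sval M).

(* S Hom(P, M) is unitary because every s in S is e s for some e in S. *)

Lemma SHom_unitary (R : rngType) (P : rngModType R) (S : subrng (endo P))
  (hS : local_units (subrng_type S)) (M : rngModType R) :
  unitary (submodule_type (SHom S M)).
Proof.
apply/seteqP; split=> // -[x xP] _.
have /asboolP[s sP xE] := xP.
suff [y yE yP] : exists2 y : submodule_type (SHom S M),
    \sum_(g <- s) g = submodule_val y & rng_prod (submodule_type (SHom S M)) y.
  by rewrite (_ : SubmoduleType xP = y) //; apply: val_inj; rewrite /= xE.
elim: s {x xP xE} sP => [|g s IHs] sP.
  by exists 0; [rewrite big_nil | exact: rng_prod0].
have [|y yE yP] := IHs; first by move=> h hs; apply: sP; rewrite inE hs orbT.
have [a _ [h _ ahE]] := sP g (mem_head _ _).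
have gP : g \in submodule_pred (SHom S M).
  apply/asboolP; exists [:: g]; last by rewrite big_seq1.
  by move=> k; rewrite inE => /eqP ->; exists a => //; exists h.
have [e ee eP] := hS [set a] (finite_set1 a).
have [r _ ra] := eP a erefl.
exists (SubmoduleType gP + y); first by rewrite big_cons yE.
apply: fin_sumsD => //; exists [:: SubmoduleType gP]; last by rewrite big_seq1.
move=> k; rewrite inE => /eqP ->; exists e => //.
exists (SubmoduleType gP) => //.
apply: val_inj => /=; rewrite -ahE rng_actA -ra.
by rewrite rng_mulA (_ : e ** (e ** r) = e ** r) // rng_mulA ee.
Qed.

Definition SHom_obj (R : rngType) (P : rngModType R) (S : subrng (endo P))
  (hS : local_units (subrng_type S)) (M : CP S) : RMod (subrng_type S) :=
  exist (@unitary (subrng_type S)) (submodule_type (SHom S (CP_module M)))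
    (SHom_unitary hS (CP_module M)).

Lemma SHom_map_subproof (R : rngType) (P : rngModType R)
  (S : subrng (endo P)) (M N : rngModType R) (h : rng_hom M N)
  (g : submodule_type (SHom S M)) :
  hom_comp (submodule_val g) h \in submodule_pred (SHom S N).
Proof.
have /asboolP gP := submodule_valP g; apply/asboolP.
apply: (@fin_sums_morph _ _ (fun k : rng_hom P M => hom_comp k h)) gP.
  by move=> f k; apply: rng_homP => x; exact: homB.
move=> _ [s _ [k _ <-]]; exists s => //; exists (hom_comp k h) => //.
exact: rng_homP.
Qed.

Definition SHom_map (R : rngType) (P : rngModType R) (S : subrng (endo P))
  (M N : rngModType R) (h : rng_hom M N) (g : submodule_type (SHom S M)) :
  submodule_type (SHom S N) := SubmoduleType (SHom_map_subproof h g).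

Lemma SHom_map_hom (R : rngType) (P : rngModType R) (S : subrng (endo P))
  (M N : rngModType R) (h : rng_hom M N) :
  @SHom_map R P S M N h
  \in @hom_pred _ (submodule_type (SHom S M)) (submodule_type (SHom S N)).
Proof.
apply/asboolP; split=> [f g|s g]; apply: val_inj; apply: rng_homP => x //=.
exact: homB.
Qed.

Definition SHom_mor (R : rngType) (P : rngModType R) (S : subrng (endo P))
  (M N : rngModType R) (h : rng_hom M N) :
  rng_hom (submodule_type (SHom S M)) (submodule_type (SHom S N)) :=
  Hom (SHom_map_hom S h).

Lemma SHom_mor_id (R : rngType) (P : rngModType R) (S : subrng (endo P))
  (M : rngModType R) : SHom_mor S (hom_id M) = hom_id _.
Proof. by apply: rng_homP => g; apply: val_inj; exact: rng_homP. Qed.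

Lemma SHom_mor_comp (R : rngType) (P : rngModType R) (S : subrng (endo P))
  (M N L : rngModType R) (f : rng_hom M N) (g : rng_hom N L) :
  SHom_mor S (hom_comp f g) = hom_comp (SHom_mor S f) (SHom_mor S g).
Proof. by apply: rng_homP => k; apply: val_inj; exact: rng_homP. Qed.

Definition SHom_functor (R : rngType) (P : rngModType R)
  (S : subrng (endo P)) (hS : local_units (subrng_type S)) :
  functor (CP S) (RMod (subrng_type S)) :=
  @Functor (CP S) (RMod (subrng_type S)) (SHom_obj hS)
    (fun M N (h : rng_hom (CP_module M) (CP_module N)) => SHom_mor S h)
    (fun M => SHom_mor_id S (CP_module M))
    (fun M N L (f : rng_hom (CP_module M) (CP_module N))
       (g : rng_hom (CP_module N) (CP_module L)) => SHom_mor_comp S f g).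

(* Main.v *)
(* For idempotent [e] in [S], the finitely generated summand [Pe] lies in one of
   the projective retracts of which [P] is the direct limit, so every map in
   [S Hom(P, -)] lifts along surjections of unitary modules and commutes with
   direct sums.  For an [S]-module [X] let [F] be the direct sum of copies of
   [P] indexed by [X].  Since [S Hom(P, P) = S], the rule
   [w |-> sum_x (w ; pr_x) x] maps [S Hom(P, F)] to [X].
   A preimage of [X] is [F / L], with [L] the largest submodule such that this
   map vanishes on [S Hom(P, L)]; it replaces the quotient of [P (x)_S X] by its
   [st], without tensor products.  The functor is full because, for
   [X = S Hom(P, M)] and [th : X -> S Hom(P, N)], the evaluation
   [F -> N] along [th] carries the kernel of the evaluation [F -> M] to a
   submodule [K] with [S Hom(P, K) = 0], hence to [st(N) = 0]. *)

Require Import Defs.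
From HB Require Import structures.
From mathcomp Require Import all_boot all_order all_algebra.
From mathcomp Require Import boolp classical_sets functions cardinality fsbigop.

Set Implicit Arguments.
Unset Strict Implicit.
Unset Printing Implicit Defensive.

Import GRing.Theory.
Local Open Scope ring_scope.
Local Open Scope classical_set_scope.

(** * Homomorphisms, submodules, and factorization through surjections *)

Section Homs.
Context (R : rngType).
Implicit Types M N L : rngModType R.

Lemma hom0 M N (f : rng_hom M N) : f 0 = 0.
Proof. by rewrite -[X in f X](subrr 0) homB subrr. Qed.

Lemma hom_sum M N (f : rng_hom M N) T (s : seq T) (F : T -> M) :
  f (\sum_(x <- s) F x) = \sum_(x <- s) f (F x).
Proof. exact: (big_morph f (homD f) (hom0 f)). Qed.

Lemma rng_homE M N (f g : rng_hom M N) : f = g -> f =1 g.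
Proof. by move->. Qed.

Lemma hom_sumE M N T (s : seq T) (F : T -> rng_hom M N) x :
  (\sum_(i <- s) F i : rng_hom M N) x = \sum_(i <- s) F i x.
Proof. by elim/big_rec2: _ => // i a b _ <-. Qed.

Lemma hom_compBl M N L (f g : rng_hom M N) (h : rng_hom N L) :
  hom_comp (f - g) h = hom_comp f h - hom_comp g h.
Proof. by apply: rng_homP => x; exact: homB. Qed.

Lemma hom_subproof M N (f : M -> N) : zmod_morphism f ->
  (forall r m, f (r *> m) = r *> f m) -> f \in @hom_pred R M N.
Proof. by move=> fB fZ; apply/asboolP. Qed.

Definition mk_hom M N (f : M -> N) (fB : zmod_morphism f)
  (fZ : forall r m, f (r *> m) = r *> f m) : rng_hom M N :=
  Defs.Hom (hom_subproof fB fZ).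

Lemma submodule_valK M (K : submodule M) (x : submodule_type K) :
  submodule_set K (submodule_val x).
Proof. by have /asboolP := submodule_valP x. Qed.

Definition in_submodule M (K : submodule M) (x : M) (Kx : submodule_set K x) :
  submodule_type K := @SubmoduleType R M K x (introT (asboolP _) Kx).

Lemma submoduleD M (K : submodule M) x y : 
  submodule_set K x -> submodule_set K y -> submodule_set K (x + y).
Proof.
move=> Kx Ky; rewrite -[y]opprK -[- y]sub0r; apply: submoduleB => //.
by apply: submoduleB => //; exact: submodule0.
Qed.

Lemma submodule_sum M (K : submodule M) (s : seq M) :
  {in s, forall x, submodule_set K x} -> submodule_set K (\sum_(x <- s) x).
Proof.
move=> Ks; rewrite big_seq; elim/big_rec: _ => [|x y xs Ky].
  exact: submodule0.
by apply: submoduleD => //; exact: Ks.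
Qed.

Lemma submodule_incl_subproof M (K : submodule M) :
  (@submodule_val R M K) \in @hom_pred R (submodule_type K) M.
Proof. by apply/asboolP. Qed.

Definition submodule_incl M (K : submodule M) : rng_hom (submodule_type K) M :=
  Defs.Hom (submodule_incl_subproof K).

Lemma corestr_subproof M N (K : submodule N) (f : rng_hom M N)
  (Kf : forall x, submodule_set K (f x)) :
  (fun x => in_submodule (Kf x)) \in @hom_pred R M (submodule_type K).
Proof.
by apply/asboolP; split=> [x y|r x]; apply: val_inj => /=;
  rewrite ?homB ?homZ.
Qed.

Definition corestr M N (K : submodule N) (f : rng_hom M N)
  (Kf : forall x, submodule_set K (f x)) : rng_hom M (submodule_type K) :=
  Defs.Hom (corestr_subproof Kf).

Lemma corestrK M N (K : submodule N) (f : rng_hom M N)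
  (Kf : forall x, submodule_set K (f x)) :
  hom_comp (corestr Kf) (submodule_incl K) = f.
Proof. exact: rng_homP. Qed.

Lemma hom_range0 M N (f : rng_hom M N) : range f 0.
Proof. by exists 0; rewrite ?hom0. Qed.

Lemma hom_rangeB M N (f : rng_hom M N) x y :
  range f x -> range f y -> range f (x - y).
Proof. by move=> [a _ <-] [b _ <-]; exists (a - b); rewrite ?homB. Qed.

Lemma hom_range_act M N (f : rng_hom M N) r x :
  range f x -> range f (r *> x).
Proof. by move=> [a _ <-]; exists (r *> a); rewrite ?homZ. Qed.

Definition hom_range M N (f : rng_hom M N) : submodule N :=
  Submodule (@hom_range0 M N f) (@hom_rangeB M N f) (@hom_range_act M N f).

Lemma hom_preim0 M N (f : rng_hom M N) (K : submodule N) : (f @^-1` K) 0.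
Proof. by rewrite /preimage /= hom0; exact: submodule0. Qed.

Lemma hom_preimB M N (f : rng_hom M N) (K : submodule N) x y :
  (f @^-1` K) x -> (f @^-1` K) y -> (f @^-1` K) (x - y).
Proof. by rewrite /preimage /= homB; exact: submoduleB. Qed.

Lemma hom_preim_act M N (f : rng_hom M N) (K : submodule N) r x :
  (f @^-1` K) x -> (f @^-1` K) (r *> x).
Proof. by rewrite /preimage /= homZ; exact: submodule_act. Qed.

Definition hom_preim M N (f : rng_hom M N) (K : submodule N) : submodule M :=
  Submodule (@hom_preim0 M N f K) (@hom_preimB M N f K)
    (@hom_preim_act M N f K).

Lemma zero_submodB M (x y : M) : [set 0] x -> [set 0] y -> [set 0] (x - y).
Proof. by move=> /= -> ->; rewrite subrr. Qed.

Lemma zero_submod_act M (r : R) (x : M) : [set 0] x -> [set 0] (r *> x).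
Proof. by move=> /= ->; rewrite rng_act0. Qed.

Definition zero_submod M : submodule M :=
  @Submodule R M [set 0] erefl (@zero_submodB M) (@zero_submod_act M).

Definition hom_ker M N (f : rng_hom M N) := hom_preim f (zero_submod N).

Lemma span_sub M (X : set M) (K : submodule M) :
  X `<=` K -> submodule_span X `<=` K.
Proof. by move=> XK x; apply; split=> //; exists K. Qed.

(** A set-theoretic section [q] of [p] is chosen. The inclusion of kernels makes [g (q y)]
    independent of the choice, hence linear in [y]. *)
Lemma hom_factor M N L (p : rng_hom M N) (g : rng_hom M L) :
  range p = [set: N] -> hom_ker p `<=` hom_ker g ->
  exists h : rng_hom N L, hom_comp p h = g.
Proof.
move=> psurj pg.
have /choice[q qK] : forall y, exists x, p x = y.
  by move=> y; have : [set: N] y by []; rewrite -psurj => -[x _ <-]; exists x.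
have gE x y : p x = p y -> g x = g y.
  move=> pxy; apply/eqP; rewrite -subr_eq0 -homB; apply/eqP/pg.
  by rewrite /= /preimage /= homB pxy subrr.
have hB : zmod_morphism (fun y => g (q y)).
  by move=> x y; rewrite -homB; apply: gE; rewrite homB !qK.
have hZ r m : g (q (r *> m)) = r *> g (q m).
  by rewrite -homZ; apply: gE; rewrite homZ !qK.
by exists (mk_hom hB hZ); apply: rng_homP => x; apply: gE; rewrite qK.
Qed.

(** Serves to compare two quotients of [S Hom(P, F)]: [X] itself and [S Hom(P, F / L)]. *)
Lemma hom_factor_iso M N L (p : rng_hom M N) (q : rng_hom M L) :
  range p = [set: N] -> range q = [set: L] ->
  (hom_ker p = hom_ker q :> set M) ->
  exists2 f : rng_hom N L, hom_comp p f = q &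
    exists2 g : rng_hom L N, hom_comp f g = hom_id N & hom_comp g f = hom_id L.
Proof.
move=> psurj qsurj pq.
have [|f pf] := hom_factor (g := q) psurj; first by rewrite pq.
have [|g qg] := hom_factor (g := p) qsurj; first by rewrite pq.
exists f => //; exists g; apply: rng_homP => x /=.
  have : [set: N] x by []; rewrite -psurj => -[y _ <-].
  by rewrite (rng_homE pf y : f (p y) = q y); exact: (rng_homE qg y).
have : [set: L] x by []; rewrite -qsurj => -[y _ <-].
by rewrite (rng_homE qg y : g (q y) = p y); exact: (rng_homE pf y).
Qed.

End Homs.

(** * Unitary modules over a ring with local units *)

Section Unitary.
Context (R : rngType).
Implicit Types M N L : rngModType R.

Lemma local_unitsE (hR : local_units R) (s : seq R) :
  exists2 e : R, rng_idem e & {in s, forall r, e ** r = r /\ r ** e = r}.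
Proof.
have [e ee eP] := hR [set` s] (finite_seq s).
exists e => // r rs; have [t _ <-] := eP r rs.
by rewrite !rng_mulA ee -[_ ** e ** e]rng_mulA ee.
Qed.

(** The condition on [e] involves only finitely many scalars, so the lists obtained for several
    elements can be concatenated before one local unit is chosen for all of them. *)
Lemma rng_prod_unit M (m : M) : rng_prod M m ->
  exists s : seq R, forall e, {in s, forall r, e ** r = r} -> e *> m = m.
Proof.
move=> [t]; elim: t m => [|x t IH] m tP ->.
  by exists [::] => e _; rewrite big_nil rng_act0.
have [|s sP] := IH _ _ erefl.
  by move=> y yt; apply: tP; rewrite inE yt orbT.
have [r _ [n _ rn]] := tP x (mem_head _ _).
exists (r :: s) => e eP; rewrite big_cons rng_actDr sP => [|u us].
  by rewrite -rn rng_actA eP // mem_head.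
by apply: eP; rewrite inE us orbT.
Qed.

Lemma unitary_units (hR : local_units R) M : unitary M -> forall s : seq M,
  exists e : R, {in s, forall m, e *> m = m}.
Proof.
move=> uM s.
suff [t tP] : exists t : seq R, forall e, {in t, forall r, e ** r = r} ->
    {in s, forall m, e *> m = m}.
  by have [e _ eP] := local_unitsE hR t; exists e; apply: tP => r /eP[].
elim: s => [|m s [t tP]]; first by exists [::].
have [u uP] : exists u : seq R, forall e, {in u, forall r, e ** r = r} ->
  e *> m = m by apply: rng_prod_unit; rewrite uM.
exists (u ++ t) => e eP n; rewrite inE => /orP[/eqP -> |].
  by apply: uP => r ru; apply: eP; rewrite mem_cat ru.
by apply: tP => r rt; apply: eP; rewrite mem_cat rt orbT.
Qed.

Lemma unitaryI M : (forall m : M, exists e : R, e *> m = m) -> unitary M.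
Proof.
move=> H; apply/seteqP; split=> // m _; have [e em] := H m.
exists [:: m]; last by rewrite big_seq1.
by move=> x; rewrite inE => /eqP ->; exists e => //; exists m.
Qed.

Lemma unitary_unit (hR : local_units R) M : unitary M -> forall m : M,
  exists e : R, e *> m = m.
Proof.
move=> uM m; have [e eP] := unitary_units hR uM [:: m].
by exists e; apply: eP; rewrite mem_head.
Qed.

Lemma unitary_submodule (hR : local_units R) M (K : submodule M) :
  unitary M -> unitary (submodule_type K).
Proof.
move=> uM; apply: unitaryI => m.
have [e em] := unitary_unit hR uM (submodule_val m).
by exists e; exact: val_inj.
Qed.

Lemma unitary_surj (hR : local_units R) M N (p : rng_hom M N) :
  unitary M -> range p = [set: N] -> unitary N.
Proof.
move=> uM psurj; apply: unitaryI => n.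
have : [set: N] n by []; rewrite -psurj => -[m _ <-].
by have [e em] := unitary_unit hR uM m; exists e; rewrite -homZ em.
Qed.

End Unitary.

(** * Direct sums of copies of a module, as finitely supported functions *)

Definition fun_mod (T : Type) (R : rngType) (M : rngModType R) := T -> M.

HB.instance Definition _ (T : Type) (R : rngType) (M : rngModType R) :=
  GRing.Zmodule.on (fun_mod T M).

Definition fun_act T (R : rngType) (M : rngModType R) (r : R)
  (f : fun_mod T M) : fun_mod T M := fun x => r *> f x.

Lemma fun_actA T (R : rngType) (M : rngModType R) (r s : R)
  (f : fun_mod T M) : fun_act r (fun_act s f) = fun_act (r ** s) f.
Proof. by apply/funext => x; exact: rng_actA. Qed.

Lemma fun_actDl T (R : rngType) (M : rngModType R) (f : fun_mod T M)
  (r s : R) : fun_act (r + s) f = fun_act r f + fun_act s f.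
Proof. by apply/funext => x; exact: rng_actDl. Qed.

Lemma fun_actDr T (R : rngType) (M : rngModType R) (r : R)
  (f g : fun_mod T M) : fun_act r (f + g) = fun_act r f + fun_act r g.
Proof. by apply/funext => x; exact: rng_actDr. Qed.

HB.instance Definition _ T (R : rngType) (M : rngModType R) :=
  Zmodule_isRngModule.Build R (fun_mod T M)
    (@fun_actA T R M) (@fun_actDl T R M) (@fun_actDr T R M).

Section Fsum.
Context (T : choiceType) (V : zmodType).

Definition supported (s : seq T) (f : T -> V) :=
  forall x, x \notin s -> f x = 0.

(** The value is 0 by convention when the support is infinite, so that maps defined by summation are
    total; [fsumE] covers the finite case. *)
Definition fsum (f : T -> V) : V := \sum_(x \in [set: T]) f x.

Lemma fsumE (s : seq T) (f : T -> V) : supported s f ->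
  fsum f = \sum_(x <- undup s) f x.
Proof.
move=> sf; rewrite /fsum (@fsbigE _ _ _ _ _ (undup s)) ?undup_uniq //.
  by apply: eq_bigl => x; rewrite in_setT.
by move=> x _; rewrite mem_undup; exact: sf.
Qed.

End Fsum.

Section DirectSum.
Context (T : choiceType) (R : rngType) (M : rngModType R).

Definition fsupp_set : set (fun_mod T M) :=
  [set f | exists s : seq T, supported s f].

Lemma fsupp0 : fsupp_set 0.
Proof. by exists [::]. Qed.

Lemma fsuppB f g : fsupp_set f -> fsupp_set g -> fsupp_set (f - g).
Proof.
move=> [s sf] [t tg]; exists (s ++ t) => x.
by rewrite mem_cat negb_or => /andP[/sf fx /tg gx]; rewrite !fctE fx gx subrr.
Qed.

Lemma fsupp_act r f : fsupp_set f -> fsupp_set (r *> f).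
Proof.
move=> [s sf]; exists s => x /sf fx.
by rewrite /rng_act /= /fun_act fx rng_act0.
Qed.

Definition fsupp : submodule (fun_mod T M) :=
  Submodule fsupp0 fsuppB fsupp_act.

Definition dsum := submodule_type fsupp.

Definition dcoord (f : dsum) : fun_mod T M := submodule_val f.

Lemma dcoordB f g x : dcoord (f - g) x = dcoord f x - dcoord g x.
Proof. by []. Qed.

Lemma dcoordZ r f x : dcoord (r *> f) x = r *> dcoord f x.
Proof. by []. Qed.

Lemma dcoord_inj (f g : dsum) : dcoord f =1 dcoord g -> f = g.
Proof. by move=> fg; apply: val_inj; apply/funext. Qed.

Lemma dsum_supp (f : dsum) : exists s, supported s (dcoord f).
Proof. exact: (submodule_valK f). Qed.

Lemma dsum_unitary (hR : local_units R) :
  unitary M -> unitary dsum.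
Proof.
move=> uM; apply: unitaryI => f; have [s sf] := dsum_supp f.
have [e eP] := unitary_units hR uM [seq dcoord f x | x <- s].
exists e; apply: dcoord_inj => x; rewrite dcoordZ.
have [xs|/sf fx] := boolP (x \in s); first by apply: eP; exact: map_f.
by rewrite fx rng_act0.
Qed.

Lemma supported_sub_subproof (s : seq T) (f g : dsum) :
  supported s (dcoord f) -> supported s (dcoord g) ->
  supported s (dcoord (f - g)).
Proof. by move=> sf sg x xs; rewrite dcoordB sf // sg // subrr. Qed.

Lemma supported_act_subproof (s : seq T) r (f : dsum) :
  supported s (dcoord f) -> supported s (dcoord (r *> f)).
Proof. by move=> sf x xs; rewrite dcoordZ sf // rng_act0. Qed.

(** With the list [s] fixed, a bound on supports is a submodule condition, so it can be tested on
    generators. *)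
Definition supported_submod (s : seq T) : submodule dsum :=
  @Submodule R dsum [set f | supported s (dcoord f)]
    (fun _ _ => erefl) (@supported_sub_subproof s)
    (@supported_act_subproof s).

Lemma dproj_subproof (x : T) :
  (fun f : dsum => dcoord f x : M) \in @hom_pred R dsum M.
Proof. by apply/asboolP. Qed.

Definition dproj (x : T) : rng_hom dsum M := Defs.Hom (dproj_subproof x).

Lemma dsumP (f g : dsum) : (forall x, dproj x f = dproj x g) -> f = g.
Proof. exact: dcoord_inj. Qed.

Lemma dinj_fsupp (x : T) (m : M) :
  submodule_set fsupp (fun y => if y == x then m else 0).
Proof. by exists [:: x] => y; rewrite inE => /negbTE ->. Qed.

Lemma dinj_subproof (x : T) :
  (fun m => in_submodule (dinj_fsupp x m)) \in @hom_pred R M dsum.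
Proof.
apply/asboolP; split=> [m n|r m]; apply: val_inj; apply/funext => y /=.
  by rewrite !fctE; case: eqP; rewrite ?subrr.
by rewrite {2}/rng_act /= /fun_act; case: eqP; rewrite ?rng_act0.
Qed.

Definition dinj (x : T) : rng_hom M dsum := Defs.Hom (dinj_subproof x).

Lemma dproj_inj x y m : dproj y (dinj x m) = if y == x then m else 0.
Proof. by []. Qed.

Lemma dsum_expand (f : dsum) s : supported s (dcoord f) ->
  f = \sum_(x <- undup s) dinj x (dproj x f).
Proof.
move=> sf; apply: dsumP => y; rewrite hom_sum.
under eq_bigr do rewrite dproj_inj.
rewrite -big_mkcond /=; have [ys|ys] := boolP (y \in s).
  rewrite -big_filter (_ : [seq x <- _ | _] = [:: y]) ?big_seq1 //.
  rewrite (_ : filter _ _ = [seq x <- undup s | pred1 y x]); last first.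
    by apply: eq_filter => x; rewrite /= eq_sym.
  by rewrite filter_pred1_uniq ?undup_uniq // mem_undup.
rewrite /= sf // big_seq_cond big1 // => x /andP[].
by rewrite mem_undup => xs /eqP yx; rewrite yx xs in ys.
Qed.

Definition dsum_map (N : rngModType R) (h : T -> rng_hom M N) (f : dsum) : N :=
  fsum (fun x => h x (dproj x f)).

Lemma dsum_mapE N (h : T -> rng_hom M N) s (f : dsum) :
  supported s (dcoord f) ->
  dsum_map h f = \sum_(x <- undup s) h x (dproj x f).
Proof. by move=> sf; apply: fsumE => x xs; rewrite /= sf // hom0. Qed.

Lemma dsum_map_subproof N (h : T -> rng_hom M N) :
  dsum_map h \in @hom_pred R dsum N.
Proof.
apply/asboolP; split=> [f g|r f].
  have [s sf] := dsum_supp f; have [t tg] := dsum_supp g.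
  have sf' : supported (s ++ t) (dcoord f).
    by move=> x; rewrite mem_cat negb_or => /andP[/sf].
  have tg' : supported (s ++ t) (dcoord g).
    by move=> x; rewrite mem_cat negb_or => /andP[_ /tg].
  rewrite (dsum_mapE _ (supported_sub_subproof sf' tg')).
  rewrite (dsum_mapE _ sf') (dsum_mapE _ tg') -sumrB.
  by apply: eq_bigr => x _; rewrite !homB.
have [s sf] := dsum_supp f.
rewrite (dsum_mapE _ (supported_act_subproof r sf)) (dsum_mapE _ sf).
rewrite (big_morph _ (rng_actDr r) (rng_act0 _ r)).
by apply: eq_bigr => x _; rewrite !homZ.
Qed.

Definition dsum_hom N (h : T -> rng_hom M N) : rng_hom dsum N :=
  Defs.Hom (dsum_map_subproof h).

Lemma dsum_hom_inj N (h : T -> rng_hom M N) x :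
  hom_comp (dinj x) (dsum_hom h) = h x.
Proof.
apply: rng_homP => m /=; have sx : supported [:: x] (dcoord (dinj x m)).
  by move=> y; rewrite inE /= => /negbTE ->.
by rewrite (dsum_mapE _ sx) /= big_seq1 /= eqxx.
Qed.

End DirectSum.

Arguments dproj {T R M} x.
Arguments dinj {T R M} x.
Arguments supported_submod {T R M} s.

(** * Quotient modules *)

Section Quotient.
Context (R : rngType) (M : rngModType R) (K : submodule M).

Definition quotmod : Type := Quotient.quot (submodule_pred K : zmodClosed M).

HB.instance Definition _ := GRing.Zmodule.on quotmod.

Definition quot_pi (x : M) : quotmod := (\pi_(quotmod) x)%qT.

Lemma quot_piB : zmod_morphism quot_pi.
Proof. by move=> x y; rewrite /quot_pi; exact: raddfB. Qed.

Lemma quot_pi_eq x y : quot_pi x = quot_pi y <-> submodule_set K (x - y).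
Proof.
split=> [/eqP|Kxy].
  by rewrite /quot_pi -Quotient.idealrBE => /asboolP.
by apply/eqP; rewrite /quot_pi -Quotient.idealrBE; apply/asboolP.
Qed.

Definition quot_act (r : R) (q : quotmod) : quotmod := quot_pi (r *> repr q).

Lemma quot_piK q : quot_pi (repr q) = q.
Proof. exact: reprK. Qed.

(** The action is defined through a chosen representative; another one differs by an element of [K],
    and [r] keeps that difference in [K]. *)
Lemma quot_piZ r x : quot_pi (r *> x) = quot_act r (quot_pi x).
Proof.
apply/quot_pi_eq; rewrite -rng_actN -rng_actDr; apply: submodule_act.
by apply/quot_pi_eq; rewrite quot_piK.
Qed.

Lemma quot_piD x y : quot_pi (x + y) = quot_pi x + quot_pi y.
Proof. by rewrite /quot_pi; exact: raddfD. Qed.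

Lemma quot_actA r s q : quot_act r (quot_act s q) = quot_act (r ** s) q.
Proof. by rewrite -[q]quot_piK -!quot_piZ rng_actA. Qed.

Lemma quot_actDl q r s : quot_act (r + s) q = quot_act r q + quot_act s q.
Proof. by rewrite -[q]quot_piK -!quot_piZ rng_actDl quot_piD. Qed.

Lemma quot_actDr r p q : quot_act r (p + q) = quot_act r p + quot_act r q.
Proof.
rewrite -[p]quot_piK -[q]quot_piK -quot_piD -!quot_piZ -quot_piD.
by rewrite rng_actDr.
Qed.

HB.instance Definition _ :=
  Zmodule_isRngModule.Build R quotmod quot_actA quot_actDl quot_actDr.

Lemma quot_proj_subproof : quot_pi \in @hom_pred R M quotmod.
Proof.
by apply/asboolP; split; [exact: quot_piB | exact: quot_piZ].
Qed.

Definition quot_proj : rng_hom M quotmod := Defs.Hom quot_proj_subproof.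

Lemma quot_proj_surj : range quot_proj = [set: quotmod].
Proof.
by apply/seteqP; split=> // q _; exists (repr q) => //; exact: quot_piK.
Qed.

Lemma quot_proj_eq0 x : quot_proj x = 0 <-> submodule_set K x.
Proof. by rewrite -[0](hom0 quot_proj) /= quot_pi_eq subr0. Qed.

End Quotient.

(** * Fully faithful and essentially surjective functors are equivalences *)

Section Equivalence.
Context (C D : category) (F : functor C D).

(** The inverse functor chooses a preimage [G0 d] and an isomorphism [i d] for each object, and
    lifts the conjugate of each morphism by these isomorphisms. Faithfulness makes the lifts unique,
    hence functorial. *)
Lemma is_equivalence_ff_es :
  (forall (a b : C) (f g : mor a b), fun_mor F f = fun_mor F g -> f = g) ->
  (forall (a b : C) (g : mor (F a) (F b)), exists f, fun_mor F f = g) ->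
  (forall d : D, exists (a : C) (f : mor (F a) d), is_iso f) ->
  is_equivalence F.
Proof.
move=> faithful full ess.
have [G0 ess0] := choice ess.
pose i d := sval (cid (ess0 d)).
have iP d : exists j : mor d (F (G0 d)),
    mor_comp (i d) j = mor_id _ /\ mor_comp j (i d) = mor_id _.
  by rewrite /i; case: cid => f [j ? ?]; exists j.
pose j d := sval (cid (iP d)).
have ij d : mor_comp (i d) (j d) = mor_id _ by rewrite /j; case: cid => ? [].
have ji d : mor_comp (j d) (i d) = mor_id _ by rewrite /j; case: cid => ? [].
pose lift a b (g : mor (F a) (F b)) := sval (cid (full a b g)).
have liftK a b g : fun_mor F (lift a b g) = g.
  exact: (svalP (cid (full a b g))).
pose Gm a b (f : mor a b) := lift (G0 a) (G0 b)
  (mor_comp (i a) (mor_comp f (j b))).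
have G1 a : Gm a a (mor_id a) = mor_id (G0 a).
  by apply: faithful; rewrite liftK fun_id mor_id_comp ij.
have GM a b c (f : mor a b) (g : mor b c) :
    Gm a c (mor_comp f g) = mor_comp (Gm a b f) (Gm b c g).
  apply: faithful; rewrite fun_comp !liftK.
  rewrite -!mor_compA; congr mor_comp; congr mor_comp.
  by rewrite (mor_compA (j b)) ji mor_id_comp.
exists (@Functor D C G0 Gm G1 GM); split.
  (* One natural isomorphism lifts [i (F a)] from [D] to [C], with the lift of [j (F a)] as inverse;
     the other is [i] itself. *)
  exists (fun a => lift (G0 (F a)) a (i (F a))).
    move=> a b f; apply: faithful; rewrite !fun_comp /= !liftK.
    by rewrite -!mor_compA ji mor_comp_id.
  move=> a; exists (lift a (G0 (F a)) (j (F a)));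
    by apply: faithful; rewrite fun_comp !liftK fun_id ?ij ?ji.
exists i => [a b f /=|d]; first by rewrite liftK -!mor_compA ji mor_comp_id.
by exists (j d); [exact: ij | exact: ji].
Qed.

End Equivalence.

(** * Split direct limits and lifting from finitely generated summands *)

Section LocallyProjective.
Context (R : rngType) (hR : local_units R).

Section Limit.
Context (d : Order.disp_t) (I : preorderType d) (Q : split_system R I)
  (P : rngModType R) (u : forall i, rng_hom (Q i) P).
Hypotheses (dirI : directed I) (Qu : forall i, unitary (Q i)) (uP : unitary P)
  (cu : cocone u)
  (univ : forall (N : rngModType R) (v : forall i, rng_hom (Q i) N),
     unitary N -> cocone v ->
     exists! h : rng_hom P N, forall i, hom_comp (u i) h = v i).

(** Up from [j] to a common bound [k], then down to [i]. By the splitting the result does not depend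
    on [k]. *)
Let back i j k (ik : (i <= k)%O) (jk : (j <= k)%O) : rng_hom (Q j) (Q i) :=
  hom_comp (sys_phi Q jk) (sys_psi Q ik).

Let back_up i j k l (ik : (i <= k)%O) (jk : (j <= k)%O) (kl : (k <= l)%O)
  (il : (i <= l)%O) (jl : (j <= l)%O) : back il jl = back ik jk.
Proof.
rewrite /back -(sys_phi_comp Q jk kl jl) -(sys_psi_comp Q ik kl il).
rewrite -hom_compA (hom_compA (sys_phi Q kl)).
by rewrite sys_split hom_id_comp.
Qed.

Let backE i j k l (ik : (i <= k)%O) (jk : (j <= k)%O) (il : (i <= l)%O)
  (jl : (j <= l)%O) : back ik jk = back il jl.
Proof.
have [m [km lm]] := dirI.2 k l.
have im := Order.PreorderTheory.le_trans ik km.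
have jm := Order.PreorderTheory.le_trans jk km.
by rewrite -(back_up ik jk km im jm) (back_up il jl lm im jm).
Qed.

(** Since [back] is independent of the bound, its instances with target [Q i] form a cocone, which
    induces [v]. At the index [i] the bound can be [i] itself, and the splitting there gives the
    identity. *)
Lemma split_limit_retract i :
  exists v : rng_hom P (Q i), hom_comp (u i) v = hom_id (Q i).
Proof.
have [k kP] := choice (fun j => dirI.2 i j).
pose w j := back (kP j).1 (kP j).2.
have cw : cocone w.
  move=> j l jl; rewrite /w.
  have jk := Order.PreorderTheory.le_trans jl (kP l).2.
  rewrite (backE (kP j).1 (kP j).2 (kP l).1 jk) /back hom_compA.
  by rewrite (sys_phi_comp Q jl _ jk).
have [v [vP _]] := univ (Qu i) cw; exists v; rewrite vP /w.
have ii := Order.PreorderTheory.lexx i.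
by rewrite (backE _ _ ii ii) /back sys_split.
Qed.

Let cover_set : set P := \bigcup_i range (u i).

Let cover_up i j (ij : (i <= j)%O) x : range (u i) x -> range (u j) x.
Proof.
move=> [y _ <-]; exists (sys_phi Q ij y) => //.
by rewrite -(cu ij).
Qed.

Let cover0 : cover_set 0.
Proof. by have [[i] _] := dirI; exists i => //; exact: hom_range0. Qed.

Let coverB x y : cover_set x -> cover_set y -> cover_set (x - y).
Proof.
move=> [i _ ix] [j _ jy]; have [k [ik jk]] := dirI.2 i j.
by exists k => //; apply: hom_rangeB; [exact: cover_up ix|exact: cover_up jy].
Qed.

Let cover_act r x : cover_set x -> cover_set (r *> x).
Proof. by move=> [i _ ix]; exists i => //; exact: hom_range_act. Qed.

(* The inclusion of the union [K] of the images splits, by the universal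
   property applied to [K] and to [P]. *)
Lemma split_limit_cover (s : seq P) :
  exists i, {in s, forall x, range (u i) x}.
Proof.
pose K := Submodule cover0 coverB cover_act.
have uK i y : submodule_set K (u i y) by exists i => //; exists y.
pose v i := corestr (@uK i).
have cv : cocone v.
  move=> i j ij; apply: rng_homP => y; apply: val_inj.
  exact: (rng_homE (cu ij) y).
have [h [hP _]] := univ (unitary_submodule hR K uP) cv.
have [h' [_ h'U]] := univ uP cu.
have hK : hom_comp h (submodule_incl K) = hom_id P.
  rewrite -(h'U (hom_id P)) => [|i]; last exact: hom_comp_id.
  symmetry; apply: h'U => i.
  by rewrite hom_compA hP corestrK.
elim: s => [|x s [i iP]]; first by have [[i] _] := dirI; exists i.
have [j _ jx] : submodule_set K x.
  rewrite -[x]/(hom_id P x) -hK; exact: submodule_valK.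
have [k [ik jk]] := dirI.2 i j; exists k => y; rewrite inE.
by move=> /orP[/eqP -> | /iP iy]; [exact: cover_up jx | exact: cover_up iy].
Qed.

End Limit.

(** Apart from unitarity, this is all that is used of local projectivity: finitely many elements lie
    in one stage of the limit, and each stage is a retract. *)
Lemma locally_projective_retract (P : rngModType R) (s : seq P) :
  locally_projective P -> exists (Q : rngModType R) (u : rng_hom Q P)
    (v : rng_hom P Q),
    [/\ projective Q, hom_comp u v = hom_id Q &
        {in s, forall x, range u x}].
Proof.
move=> [uP [d [I [Q [dirI Qi [u cu univ]]]]]].
have Qu i : unitary (Q i) by case: (Qi i).
have [i iP] := split_limit_cover dirI uP cu univ s.
have [v uv] := split_limit_retract dirI Qu univ i.
by exists (Q i), (u i), v; split=> //; case: (Qi i).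
Qed.

(* [g] factors through the finitely generated summand [range e] of [P], which
   lies in a projective retract of [P]. *)
Lemma lift_fin_gen (P : rngModType R) (e : endo P) (M N : rngModType R)
  (p : rng_hom M N) (g : rng_hom P N) :
  locally_projective P -> fin_gen (range e) -> hom_comp e g = g ->
  unitary M -> range g `<=` range p ->
  exists h : rng_hom P M, hom_comp h p = g.
Proof.
move=> lP [X /finite_seqP[s ->] eX] eg uM gp.
have [Q [u [v [pQ uv us]]]] := locally_projective_retract s lP.
have eu : range e `<=` range u.
  by rewrite eX; apply: (@span_sub _ _ _ (hom_range u)) => x /us.
(* Projectivity concerns surjections, while [p] need not be one; its target is cut down to its
   image, which contains that of [g]. *)
pose p' := corestr (K := hom_range p) (f := p) (fun x => imageT p x).
have Kg x : submodule_set (hom_range p) (g x).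
  by apply: gp; exact: imageT.
have p'surj : range p' = [set: _].
  apply/seteqP; split=> // y _; have [x _ xy] := submodule_valK y.
  by exists x => //; exact: val_inj.
have [h hp] := pQ _ _ p' (hom_comp u (corestr Kg)) uM
  (unitary_surj hR uM p'surj) p'surj.
(* Starting with [e] lands in the image of [u], where [v] followed by [u] is the identity; then
   [e g = g] finishes. *)
exists (hom_comp e (hom_comp v h)); apply: rng_homP => x /=.
have /(congr1 (@submodule_val _ _ _)) /= := rng_homE hp (v (e x)).
move=> ->; have [y _ uy] : range u (e x) by apply: eu; exact: imageT.
have vu : v (u y) = y := rng_homE uv y.
by rewrite -uy vu uy; exact: (rng_homE eg x).
Qed.

End LocallyProjective.

Lemma fin_sums_gen (V : zmodType) (X : set V) x : X x -> fin_sums X x.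
Proof.
move=> Xx; exists [:: x]; last by rewrite big_seq1.
by move=> y; rewrite inE => /eqP ->.
Qed.

Lemma fin_sums_sum (V : zmodType) (X : set V) (T : eqType) (s : seq T)
  (F : T -> V) :
  {in s, forall i, fin_sums X (F i)} -> fin_sums X (\sum_(i <- s) F i).
Proof.
move=> XF; rewrite big_seq; elim/big_rec: _ => [|i x si Xx].
  by exists [::] => //; rewrite big_nil.
exact: fin_sumsD (XF i si) Xx.
Qed.

(** * Lifting and finiteness for maps in [S Hom(P, -)] *)

Section Morita.
Context (R : rngType) (hR : local_units R) (P : rngModType R)
  (S : subrng (endo P)) (hS : local_units (subrng_type S)).
Implicit Types M N : rngModType R.

Hypothesis hP : locally_projective P.
Hypothesis hPS :
  fin_sums [set (s : endo P) x | s in subrng_set S & x in [set: P]] = [set: P].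
Hypothesis hSE :
  fin_sums [set s ** g | s in subrng_set S & g in [set: endo P]]
  = subrng_set S.
Hypothesis hfg : forall f : endo P, subrng_set S f -> rng_idem f ->
  fin_gen (range f).

Let uP : unitary P := hP.1.

Lemma subrng_valK (s : subrng_type S) : subrng_set S (subrng_val s).
Proof. by have /asboolP := subrng_valP s. Qed.

Lemma subrng_comp (s g : endo P) : subrng_set S s ->
  subrng_set S (hom_comp s g).
Proof.
by move=> Ss; rewrite -hSE; apply: fin_sums_gen; exists s => //; exists g.
Qed.

(** An expression of [g] as a finite sum has finitely many left factors in [S], and one idempotent
    of [S] is a unit for all of them. *)
Lemma SHomP M (g : rng_hom P M) : submodule_set (SHom S M) g <->
  exists2 e : endo P, subrng_set S e & rng_idem e /\ hom_comp e g = g.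
Proof.
split=> [/rng_prod_unit[s sg]|[e Se [_ eg]]].
  have [e ee es] := local_unitsE hS s; exists (subrng_val e).
    exact: subrng_valK.
  split; first exact: (congr1 val ee).
  by apply: (sg e) => r /es[].
apply: fin_sums_gen; exists (SubrngType (introT (asboolP _) Se)) => //.
by exists g.
Qed.

Lemma SHom_compl M (s : endo P) (g : rng_hom P M) : subrng_set S s ->
  submodule_set (SHom S M) (hom_comp s g).
Proof.
move=> Ss; apply: fin_sums_gen.
exists (SubrngType (introT (asboolP _) Ss)) => //.
by exists g.
Qed.

Lemma SHom_compr M N (g : rng_hom P M) (h : rng_hom M N) :
  submodule_set (SHom S M) g -> submodule_set (SHom S N) (hom_comp g h).
Proof.
by move=> /SHomP[e Se [ee eg]]; rewrite -eg -hom_compA; exact: SHom_compl.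
Qed.

(** Rests on [S End(P) = S], by which [S] absorbs endomorphisms on the right. *)
Lemma SHom_endo (g : endo P) :
  submodule_set (SHom S P) g -> subrng_set S g.
Proof. by move=> /SHomP[e Se [_ <-]]; exact: subrng_comp. Qed.

(** Any lift of [g = e g] can be precomposed with [e], which puts it in [S Hom(P, M)] and leaves it
    a lift. Asking only for an inclusion of images allows [p] to be non-surjective. *)
Lemma SHom_lift M N (p : rng_hom M N) (g : rng_hom P N) :
  submodule_set (SHom S N) g -> unitary M -> range g `<=` range p ->
  exists2 h : rng_hom P M, submodule_set (SHom S M) h & hom_comp h p = g.
Proof.
move=> /SHomP[e Se [ee eg]] uM gp.
have [h hp] := lift_fin_gen hR hP (hfg Se ee) eg uM gp.
exists (hom_comp e h); first exact: SHom_compl.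
by rewrite -hom_compA hp.
Qed.

(** The list [s] generates [Pe] for an idempotent [e] with [e g = g], so the values of [g] on [s]
    generate its image. *)
Lemma SHom_fin_gen M (g : rng_hom P M) : submodule_set (SHom S M) g ->
  exists s : seq P, forall K : submodule M,
    {in s, forall x, submodule_set K (g x)} -> range g `<=` K.
Proof.
move=> /SHomP[e Se [ee eg]]; have [X /finite_seqP[s ->] eX] := hfg Se ee.
exists s => K Ks _ [y _ <-].
have : range e (e y) by exact: imageT.
rewrite eX => /(@span_sub _ _ _ (hom_preim g K)).
rewrite /= /preimage /= (rng_homE eg y : g (e y) = g y); apply=> x.
exact: Ks.
Qed.

(** Endomorphisms outside [S] are sent to the default 0, which lets [contract] be defined on all
    maps. *)
Definition subrng_in (v : endo P) : subrng_type S := insubd 0 v.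

Lemma subrng_inK v : subrng_set S v -> subrng_val (subrng_in v) = v.
Proof. by move=> Sv; apply: insubdK; apply/asboolP. Qed.

(** * The contraction from [S Hom(P, F)] to [X] *)

Section FreeCover.
Context (X : rngModType (subrng_type S)).

Local Notation F := (dsum X P).

Let uF : unitary F := dsum_unitary X hR uP.

(* A map [w] in [S Hom(P, F)] has finite support, and its components
   [w ; dproj x] lie in [S End(P) = S]: this is the isomorphism
   [S Hom(P, F) = S^(X)] followed by [S^(X) -> X]. *)
Definition contract (w : rng_hom P F) : X :=
  fsum (fun x => subrng_in (hom_comp w (dproj x)) *> x).

Lemma SHom_dproj (w : rng_hom P F) x : submodule_set (SHom S F) w ->
  subrng_val (subrng_in (hom_comp w (dproj x))) = hom_comp w (dproj x).
Proof. by move=> Sw; apply/subrng_inK/SHom_endo/SHom_compr. Qed.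

(** The image of [w] is finitely generated, and the supports of its generators are concatenated into
    one list. *)
Lemma SHom_supported (w : rng_hom P F) : submodule_set (SHom S F) w ->
  exists s : seq X, forall y, supported s (dcoord (w y)).
Proof.
move=> /SHom_fin_gen[t tw].
suff [s st] : exists s : seq X, {in t, forall y, supported s (dcoord (w y))}.
  by exists s => y; apply: (tw (supported_submod s) st); exact: imageT.
elim: {tw}t => [|y t [s st]]; first by exists [::].
have [u yu] := dsum_supp (w y); exists (u ++ s) => z; rewrite inE => zt x.
rewrite mem_cat negb_or => /andP[xu xs].
by case/orP: zt => [/eqP ->|/st]; [exact: yu | apply].
Qed.

Lemma contractE (w : rng_hom P F) s : submodule_set (SHom S F) w ->
  (forall y, supported s (dcoord (w y))) ->
  contract w = \sum_(x <- undup s) subrng_in (hom_comp w (dproj x)) *> x.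
Proof.
move=> Sw sw; apply: fsumE => x xs.
have -> : subrng_in (hom_comp w (dproj x)) = 0.
  apply: val_inj; rewrite /= SHom_dproj //; apply: rng_homP => y.
  exact: sw.
by apply: (addrI (0 *> x)); rewrite -rng_actDl !addr0.
Qed.

Lemma contractB (v w : rng_hom P F) :
  submodule_set (SHom S F) v -> submodule_set (SHom S F) w ->
  contract (v - w) = contract v - contract w.
Proof.
move=> Sv Sw; have [s sv] := SHom_supported Sv.
have [t tw] := SHom_supported Sw.
have sv' y : supported (s ++ t) (dcoord (v y)).
  by move=> x; rewrite mem_cat negb_or => /andP[/sv].
have tw' y : supported (s ++ t) (dcoord (w y)).
  by move=> x; rewrite mem_cat negb_or => /andP[_ /tw].
have Svw := submoduleB Sv Sw.
rewrite (contractE Sv sv') (contractE Sw tw').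
rewrite (@contractE _ (s ++ t) Svw) => [|y].
  rewrite -sumrB; apply: eq_bigr => x _; apply/eqP.
  rewrite eq_sym subr_eq -rng_actDl; apply/eqP; congr (_ *> _).
  apply: val_inj; rewrite /= !SHom_dproj // hom_compBl.
  by rewrite subrK.
exact: (supported_sub_subproof (sv' y) (tw' y)).
Qed.

Lemma contractZ (s : subrng_type S) (w : rng_hom P F) :
  submodule_set (SHom S F) w ->
  contract (hom_comp (subrng_val s) w) = s *> contract w.
Proof.
move=> Sw; have [t tw] := SHom_supported Sw.
have Ssw : submodule_set (SHom S F) (hom_comp (subrng_val s) w).
  by apply: SHom_compl; exact: subrng_valK.
rewrite (contractE Sw tw) (contractE Ssw (fun y => tw _)).
rewrite (big_morph _ (rng_actDr s) (rng_act0 _ s)); apply: eq_bigr => x _.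
rewrite rng_actA; congr (_ *> _); apply: val_inj.
by rewrite /= !SHom_dproj //; exact: rng_homP.
Qed.

(** If [e] in [S] satisfies [e x = x], then [e] followed by [dinj x] has [e] as its component at [x]
    and 0 elsewhere, so it contracts to [e x]. *)
Lemma contract_surj : unitary X ->
  forall x : X, exists2 w : rng_hom P F,
    submodule_set (SHom S F) w & contract w = x.
Proof.
move=> uX x; have [e ex] := unitary_unit hS uX x.
have Sw : submodule_set (SHom S F) (hom_comp (subrng_val e) (dinj x)).
  by apply: SHom_compl; exact: subrng_valK.
exists (hom_comp (subrng_val e) (dinj x)) => //.
rewrite (@contractE _ [:: x]) ?big_seq1 // => [|y z]; last first.
  by rewrite inE /dcoord /= => /negbTE ->.
rewrite -[RHS]ex; congr (_ *> _); apply: val_inj; rewrite /= SHom_dproj //.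
by apply: rng_homP => y /=; rewrite eqxx.
Qed.

(** By [S]-linearity of [h], both sides are the sum over [x] of the component of [w] at [x] followed
    by [h x]. Thus evaluating along [h] depends on [w] only through its contraction. *)
Lemma contract_natural N (h : rng_hom X (submodule_type (SHom S N)))
  (w : rng_hom P F) : submodule_set (SHom S F) w ->
  hom_comp w (dsum_hom (fun x => submodule_val (h x)))
  = submodule_val (h (contract w)).
Proof.
move=> Sw; have [s sw] := SHom_supported Sw.
rewrite (contractE Sw sw) -[RHS]/(hom_comp h (submodule_incl _) _) hom_sum.
apply: rng_homP => y; rewrite hom_sumE /= (dsum_mapE _ (sw y)).
apply: eq_bigr => x _; rewrite homZ /=.
by rewrite SHom_dproj.
Qed.

(** * Null submodules of [F] and the largest one among them *)

Definition null (K : submodule F) : Prop :=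
  forall w : rng_hom P F, submodule_set (SHom S F) w -> range w `<=` K ->
  contract w = 0.

(** A plain union suffices instead of a sum, because [null_sum] makes the family of null submodules
    directed. *)
Definition radical_set : set F :=
  [set f | exists2 K : submodule F, null K & submodule_set K f].

Lemma contract0 : contract 0 = 0.
Proof.
have S0 := submodule0 (SHom S F).
by rewrite -[X in contract X](subrr 0) (contractB S0 S0) subrr.
Qed.

Lemma contractD (v w : rng_hom P F) :
  submodule_set (SHom S F) v -> submodule_set (SHom S F) w ->
  contract (v + w) = contract v + contract w.
Proof.
move=> Sv Sw; apply/eqP; rewrite -subr_eq -contractB ?addrK //.
exact: submoduleD.
Qed.

Lemma null_zero : null (zero_submod F).
Proof.
move=> w _ w0; rewrite (_ : w = 0) ?contract0 //; apply: rng_homP => y.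
by apply: w0; exact: imageT.
Qed.

(* A map into [K + K'] lifts modulo [K] to a map into [K']. *)
Lemma null_sum K K' : null K -> null K' ->
  exists K'', [/\ null K'', (K : set F) `<=` K'' & (K' : set F) `<=` K''].
Proof.
move=> nK nK'; pose p := hom_comp (submodule_incl K') (quot_proj K).
(* This is [K + K'], written as the preimage of the image of [K'] in [F / K]. *)
exists (hom_preim (quot_proj K) (hom_range p)); split.
- move=> w Sw wK.
  have [|v Sv vp] := SHom_lift (p := p) (SHom_compr (quot_proj K) Sw)
    (unitary_submodule hR K' uF).
    by move=> _ [y _ <-]; apply: (wK (w y)); exact: imageT.
  pose w' := hom_comp v (submodule_incl K').
  have Sw' : submodule_set (SHom S F) w' by exact: SHom_compr.
  (* In [w = (w - w') + w'] the first summand maps into [K] and the second into [K'], so both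
     contract to 0. *)
  rewrite -[w](subrK w') contractD ?(nK (w - w')) ?(nK' w') ?addr0 //.
  - by move=> _ [y _ <-]; exact: submodule_valK.
  - exact: submoduleB.
  - move=> _ [y _ <-]; apply/quot_proj_eq0.
    rewrite homB (rng_homE vp y : quot_proj K (w' y) = quot_proj K (w y)).
    by rewrite subrr.
  - exact: submoduleB.
- move=> f Kf; exists 0 => //; rewrite hom0.
  by symmetry; apply/quot_proj_eq0.
- move=> f K'f; by exists (in_submodule K'f).
Qed.

Lemma radical0 : radical_set 0.
Proof. by exists (zero_submod F) => //; exact: null_zero. Qed.

Lemma radicalB f g : radical_set f -> radical_set g -> radical_set (f - g).
Proof.
move=> [K nK Kf] [K' nK' K'g]; have [L [nL KL K'L]] := null_sum nK nK'.
by exists L => //; apply: submoduleB; [exact: KL | exact: K'L].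
Qed.

Lemma radical_act r f : radical_set f -> radical_set (r *> f).
Proof. by move=> [K nK Kf]; exists K => //; exact: submodule_act. Qed.

Definition radical : submodule F := Submodule radical0 radicalB radical_act.

(** The image of a map in [S Hom(P, F)] is finitely generated, so once inside the directed union it
    lies in a single null submodule. *)
Lemma null_radical : null radical.
Proof.
move=> w Sw wL; have [s sP] := SHom_fin_gen Sw.
suff [K nK Ks] : exists2 K, null K & {in s, forall y, submodule_set K (w y)}.
  by apply: nK => //; exact: sP.
elim: {sP}s => [|y s [K nK Ks]].
  by exists (zero_submod F) => //; exact: null_zero.
have [K' nK' K'y] : radical_set (w y) by apply: wL; exact: imageT.
have [L [nL KL K'L]] := null_sum nK nK'; exists L => // z.
by rewrite inE => /orP[/eqP ->|/Ks]; [exact: K'L | exact: KL].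
Qed.

(** A map [v] into the image of [w] lifts through [w] as [v = h w] with [h] in [S], and contraction
    is [S]-linear. *)
Lemma null_range (w : rng_hom P F) : submodule_set (SHom S F) w ->
  contract w = 0 -> null (hom_range w).
Proof.
move=> Sw w0 v Sv vw; have [h Sh <-] := SHom_lift Sv uP vw.
by rewrite -(subrng_inK (SHom_endo Sh)) contractZ // w0 rng_act0.
Qed.

(** If [w] contracts to 0, its image is null and hence inside [radical]; the converse is
    [null_radical]. *)
Lemma contract_eq0 (w : rng_hom P F) : submodule_set (SHom S F) w ->
  contract w = 0 <-> hom_comp w (quot_proj radical) = 0.
Proof.
move=> Sw; split=> [w0|/rng_homE w0].
  apply: rng_homP => y; apply/quot_proj_eq0.
  by exists (hom_range w); [exact: null_range | exact: imageT].
by apply: null_radical => // _ [y _ <-]; apply/quot_proj_eq0; exact: w0.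
Qed.

(** * The preimage [F / L] of [X], and its membership in the category [CP] *)

Definition realization := quotmod radical.

Lemma realization_unitary : unitary realization.
Proof. exact: (unitary_surj hR uF (quot_proj_surj radical)). Qed.

(** If [S Hom(P, K) = 0], a map into the preimage of [K] in [F] becomes 0 in the quotient, hence
    contracts to 0. The preimage is therefore null and lies in [radical], so [K] is 0. *)
Lemma realization_st : st S realization = [set 0].
Proof.
apply/seteqP; split=> [q|_ ->]; last by exists [::] => //; rewrite big_nil.
move=> [t tP ->]; apply: (submodule_sum (K := zero_submod _)).
move=> x /tP[K /= K0 Kx].
pose p := quot_proj radical.
suff nK : null (hom_preim p K).
  have [f _ fx] : range p x by rewrite quot_proj_surj.
  rewrite -fx in Kx *; apply/quot_proj_eq0; by exists (hom_preim p K).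
move=> w Sw wK; apply/contract_eq0 => //.
have wpK y : submodule_set K (hom_comp w p y).
  by apply: (wK (w y)); exact: imageT.
have /= c0 : [set 0] (corestr wpK).
  rewrite -K0; have /SHomP[e Se [ee ew]] := SHom_compr p Sw.
  apply/SHomP; exists e => //.
  by split=> //; apply: rng_homP => y; apply: val_inj; exact: (rng_homE ew y).
apply: rng_homP => y.
by rewrite -(corestrK wpK) c0.
Qed.

(** Here [PS = P] enters: every coordinate of an element of [F] is a finite sum of values of
    elements of [S]. *)
Lemma realization_sTr : sTr S realization = [set: realization].
Proof.
apply/seteqP; split=> // q _; pose p := quot_proj radical.
have [f _ <-] : range p q by rewrite quot_proj_surj.
have [s sf] := dsum_supp f; rewrite (dsum_expand sf) hom_sum.
apply: fin_sums_sum => x _.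
have [t tP ->] : fin_sums
    [set (v : endo P) y | v in subrng_set S & y in [set: P]] (dproj x f).
  by rewrite hPS.
rewrite -[p _]/(hom_comp (dinj x) p _) hom_sum.
apply: fin_sums_sum => _ /tP[v Sv [y _ <-]]; apply: fin_sums_gen.
by exists (hom_comp v (hom_comp (dinj x) p)); [exact: SHom_compl | exists y].
Qed.

(** [S Hom(P, F)] maps onto [S Hom(P, F / L)] by lifting and onto [X] by contraction, with the same
    kernel by [contract_eq0]. *)
Lemma realization_iso : unitary X ->
  exists f : rng_hom (submodule_type (SHom S realization)) X,
  exists2 g, hom_comp f g = hom_id _ & hom_comp g f = hom_id _.
Proof.
move=> uX; pose p := quot_proj radical.
have cB : zmod_morphism
    (fun w : submodule_type (SHom S F) => contract (submodule_val w)).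
  by move=> v w; rewrite -contractB //; exact: submodule_valK.
have cZ s (w : submodule_type (SHom S F)) :
    contract (submodule_val (s *> w)) = s *> contract (submodule_val w).
  by rewrite -contractZ //; exact: submodule_valK.
have [|||f _ fP] := @hom_factor_iso _ _ _ _ (SHom_mor S p) (mk_hom cB cZ).
- apply/seteqP; split=> // g _.
  have [|w Sw wp] := SHom_lift (submodule_valK g) uF (p := p).
    by rewrite quot_proj_surj.
  by exists (in_submodule Sw) => //; apply: val_inj.
- apply/seteqP; split=> // x _; have [w Sw wx] := contract_surj uX x.
  by exists (in_submodule Sw).
- apply/seteqP; split=> w /= w0.
    by apply/(contract_eq0 (submodule_valK w)); exact: (congr1 val w0).
  by apply: val_inj; apply/(contract_eq0 (submodule_valK w)).
by exists f.
Qed.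

End FreeCover.

(** * Faithfulness and fullness of [S Hom(P, -)] *)

Lemma st_sub M (K : submodule M) :
  (SHom S (submodule_type K) : set _) = [set 0] -> (K : set M) `<=` st S M.
Proof. by move=> K0 x Kx; apply: fin_sums_gen; exists K. Qed.

(** The two maps agree on the images of maps in [S Hom(P, M)], and these images generate [M]. *)
Lemma SHom_faithful M N (f g : rng_hom M N) : sTr S M = [set: M] ->
  SHom_mor S f = SHom_mor S g -> f = g.
Proof.
move=> sM fg; apply: rng_homP => m; have : [set: M] m by [].
rewrite -sM => -[t tP ->]; rewrite !hom_sum.
apply: eq_big_seq => x /tP[k Sk [y _ <-]].
have /(congr1 (@submodule_val _ _ _)) := rng_homE fg (in_submodule Sk).
by move=> /rng_homE/(_ y).
Qed.

Lemma SHom_full M N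
  (th : rng_hom (submodule_type (SHom S M)) (submodule_type (SHom S N))) :
  sTr S M = [set: M] -> st S N = [set 0] ->
  exists h : rng_hom M N, SHom_mor S h = th.
Proof.
move=> sM sN; pose X := submodule_type (SHom S M).
pose ev : rng_hom (dsum X P) M := dsum_hom (fun g : X => submodule_val g).
pose evt : rng_hom (dsum X P) N := dsum_hom (fun g : X => submodule_val (th g)).
have ev_surj : range ev = [set: M].
  apply/seteqP; split=> // m _; have : [set: M] m by [].
  rewrite -sM => -[t tP ->]; apply: (submodule_sum (K := hom_range ev)).
  move=> x /tP[k Sk [y _ <-]].
  exists (dinj (in_submodule Sk : X) y) => //.
  exact: (rng_homE (dsum_hom_inj _ _) y).
have kerK : hom_ker ev `<=` hom_ker evt.
  pose K := hom_range (hom_comp (submodule_incl (hom_ker ev)) evt).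
  suff K0 : (SHom S (submodule_type K) : set _) = [set 0].
    move=> x Kx; have : (st S N) (evt x).
      by apply: (st_sub K0); exists (in_submodule Kx).
    by rewrite sN.
  apply/seteqP; split=> [w Sw|_ ->]; last exact: submodule0.
  have Sw' := SHom_compr (submodule_incl K) Sw.
  have uker : unitary (submodule_type (hom_ker ev)).
    by apply: (unitary_submodule hR); exact: dsum_unitary.
  (* By construction [K] is the image of the kernel of [ev] under [evt], so a map into [K] lifts to
     that kernel. *)
  have [|v Sv vw] := SHom_lift Sw' uker
      (p := hom_comp (submodule_incl (hom_ker ev)) evt).
    by move=> _ [y _ <-]; exact: (submodule_valK (w y)).
  have Sv' := SHom_compr (submodule_incl (hom_ker ev)) Sv.
  have c0 : contract (hom_comp v (submodule_incl (hom_ker ev))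
      : rng_hom P (dsum X P)) = 0.
    (* For the identity of [X = S Hom(P, M)], naturality says that the contraction is the lift
       followed by [ev], which is 0 on the kernel. *)
    apply: val_inj; apply: (etrans (esym (contract_natural (hom_id X) Sv'))).
    by apply: rng_homP => y; exact: (submodule_valK (v y)).
  apply: rng_homP => y; apply: val_inj.
  have := rng_homE vw y; rewrite hom_compA (contract_natural th Sv') c0 hom0.
  by move/esym.
(* On the summand of index [g], [ev] is [g] and [evt] is [th g], so the factorization restricts
   there to [g h = th g]. *)
have [h hE] := hom_factor ev_surj kerK; exists h; apply: rng_homP => g.
apply: val_inj => /=.
rewrite -(dsum_hom_inj (fun g : X => submodule_val g)) -hom_compA hE.
exact: dsum_hom_inj.
Qed.

End Morita.

(** * The equivalence, from faithfulness, fullness and the realization of each unitary [S]-module *)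

Theorem theoremA (R : rngType) (hR : local_units R)
  (P : rngModType R) (hP : locally_projective P)
  (S : subrng (endo P)) (hS : local_units (subrng_type S))
  (hPS : fin_sums [set (s : endo P) x | s in subrng_set S & x in [set: P]]
         = [set: P])
  (hSE : fin_sums [set s ** g | s in subrng_set S & g in [set: endo P]]
         = subrng_set S)
  (hfg : forall f : endo P, subrng_set S f -> rng_idem f ->
           fin_gen (range f)) :
  is_equivalence (SHom_functor hS).
Proof.
apply: is_equivalence_ff_es.
- move=> [[M uM] [stM sTrM]] N f g; exact: SHom_faithful.
- move=> [[M uM] [stM sTrM]] [[N uN] [stN sTrN]] g.
  by have [h hg] := SHom_full hR hS hP hSE hfg g sTrM stN; exists h.
- move=> [X uX].
  exists (exist _ (exist _ _ (realization_unitary hR hS hP hSE hfg X))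
    (conj (realization_st hR hS hP hSE hfg X)
          (realization_sTr hR hS hP hPS hSE hfg X))).
  exact: realization_iso.
Qed.
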